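(* The SS2-xn scheme is energy-preserving: its numerical solution satisfies $$\boldsymbol H(\boldsymbol x^{n+1},\bar t^{\,n+1},\boldsymbol v^{n+1},w^{n+1})=\boldsymbol H(\boldsymbol x^{n},\bar t^{\,n},\boldsymbol v^{n},w^{n})$$ for every step $n$, where $\boldsymbol H(\boldsymbol x,\bar t,\boldsymbol v,w)=\tfrac12\|\boldsymbol v\|^2+\tfrac12w^2$.
   Context: Let $0<\varepsilon\ll1$. $\boldsymbol E=(E_1,E_2,E_3)^{\intercal}=-\nabla U$ is an electric field and $\boldsymbol B=(B_1,B_2,B_3)^{\intercal}$ a magnetic field on $\mathbb R^3$. The variables are $\boldsymbol y=(\boldsymbol x^{\intercal},\bar t)^{\intercal}$ and $\boldsymbol u=(\boldsymbol v^{\intercal},w)^{\intercal}$, 4-component vectors with $\boldsymbol x,\boldsymbol v\in\mathbb R^3$ and $\bar t=it$, $w=i\gamma$ purely imaginary, so that $w^2$ is the (non-conjugated) square. The relativistic charged-particle system is $\dot{\boldsymbol y}=\boldsymbol u$, $\dot{\boldsymbol u}=\boldsymbol F(\boldsymbol x)\boldsymbol u$ with $$\boldsymbol F(\boldsymbol x)=\frac{\widehat{\widehat{\boldsymbol B}}(\varepsilon\boldsymbol x)}{\varepsilon}+\widehat{\boldsymbol E}(\boldsymbol x),\quad \widehat{\widehat{\boldsymbol B}}=\begin{pmatrix}\widehat{\boldsymbol B}&\boldsymbol 0\\ \boldsymbol 0&0\end{pmatrix},\quad \widehat{\boldsymbol B}=\begin{pmatrix}0&B_3&-B_2\\ -B_3&0&B_1\\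 B_2&-B_1&0\end{pmatrix},\quad \widehat{\boldsymbol E}=\begin{pmatrix}\boldsymbol 0&-i\boldsymbol E\\ i\boldsymbol E^{\intercal}&0\end{pmatrix}.$$ **SS2-xn scheme.** With step $h>0$ and $\varphi_1(s)=(\mathrm e^s-1)/s$ (entire function applied to matrices), $$\boldsymbol y^{n+1}=\boldsymbol y^n+\tfrac h2\varphi_1\!\big(\tfrac h2\boldsymbol F^n\big)\Big(I_4+\mathrm e^{h(\boldsymbol F_{\bar{\boldsymbol x}^n}-\boldsymbol F^n)}\mathrm e^{\frac h2\boldsymbol F^n}\Big)\boldsymbol u^n,\qquad \boldsymbol u^{n+1}=\mathrm e^{\frac h2\boldsymbol F^n}\mathrm e^{h(\boldsymbol F_{\bar{\boldsymbol x}^n}-\boldsymbol F^n)}\mathrm e^{\frac h2\boldsymbol F^n}\boldsymbol u^n,$$ where $\bar{\boldsymbol y}^n=\boldsymbol y^n+\frac h2\varphi_1(\frac h2\boldsymbol F^n)\boldsymbol u^n$, $\boldsymbol x^n$, $\bar{\boldsymbol x}^n$ are the first three components of $\boldsymbol y^n$, $\bar{\boldsymbol y}^n$, $\boldsymbol F^n=\boldsymbol F(\boldsymbol x^n)$, $\boldsymbol F_{\bar{\boldsymbol x}^n}=\boldsymbol F(\bar{\boldsymbol x}^n)$, and $\boldsymbol y^n=((\boldsymbol x^n)^{\intercal},\bar t^{\,n})^{\intercal}$, $\boldsymbol u^n=((\boldsymbol v^n)^{\intercal},w^n)^{\intercal}$. *)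

(* Defs.v *)
From HB Require Import structures.
From mathcomp Require Import all_boot all_order all_algebra.
From mathcomp Require Import complex.
From mathcomp Require Import all_classical all_reals all_analysis.
Import Order.TTheory GRing.Theory Num.Theory numFieldNormedType.Exports.

Set Implicit Arguments.
Unset Strict Implicit.
Unset Printing Implicit Defensive.

Local Open Scope ring_scope.
Local Open Scope complex_scope.
Local Open Scope classical_set_scope.

(* Value at a square matrix of the entire function with Taylor coefficients
   a 0, a 1, ..., as the limit of the partial sums of \sum_k a_k A^k. *)
Definition mx_entire (K : numFieldType) (m : nat) (a : nat -> K)
    (A : 'M[K]_m.+1) : 'M[K]_m.+1 :=
  limn (series (fun k => a k *: A ^+ k)).

Definition mx_exp (K : numFieldType) (m : nat) (A : 'M[K]_m.+1) :=
  mx_entire (fun k => (k`!%:R)^-1) A.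

(* (e^s - 1) / s = \sum_k s^k / (k+1)! *)
Definition mx_phi1 (K : numFieldType) (m : nat) (A : 'M[K]_m.+1) :=
  mx_entire (fun k => (k.+1`!%:R)^-1) A.

Section ChargedParticle.
Variable R : realType.
Implicit Types (eps h s : R) (x : 'cV[R]_3) (E B : 'cV[R]_3 -> 'cV[R]_3).

Definition gradient (U : 'cV[R]_3 -> R) x : 'cV[R]_3 :=
  \col_j 'D_(delta_mx j 0) U x.

Definition toC (m p : nat) (A : 'M[R]_(m, p)) : 'M[R[i]]_(m, p) :=
  map_mx (real_complex R) A.

(* The 4-vector (a, i s) with real spatial part a and imaginary last entry. *)
Definition vec4 (a : 'cV[R]_3) s : 'cV[R[i]]_4 :=
  col_mx (toC a) (('i * s%:C)%:M : 'cV[R[i]]_1).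

Definition spatial (z : 'cV[R[i]]_4) : 'cV[R[i]]_3 :=
  usubmx (z : 'cV[R[i]]_(3 + 1)).

Definition last_entry (z : 'cV[R[i]]_4) : R[i] := z ord_max 0.

(* The fields live on R^3, whereas the scheme computes in C^4; a position is
   read off as the real part of the spatial entries, which are real along
   numerical solutions started from vec4 data. *)
Definition position (z : 'cV[R[i]]_4) : 'cV[R]_3 :=
  \col_j complex.Re (spatial z j 0).

Definition Bhat (b : 'cV[R]_3) : 'M[R]_3 :=
  let b1 := b 0 0 in let b2 := b 1 0 in let b3 := b 2%:R 0 in
  \matrix_(j < 3, k < 3)
    nth 0 (nth [::] [:: [::   0;   b3; - b2];
                        [:: - b3;   0;   b1];
                        [::   b2; - b1;   0]] j) k.

Definition Bhathat (b : 'cV[R]_3) : 'M[R[i]]_4 :=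
  block_mx (toC (Bhat b)) 0
           0              (0 : 'M[R[i]]_(1, 1)).

Definition Ehat (e : 'cV[R]_3) : 'M[R[i]]_4 :=
  block_mx 0                   (- 'i *: toC e)
           ('i *: (toC e)^T)   (0 : 'M[R[i]]_(1, 1)).

Definition Fmx eps E B x : 'M[R[i]]_4 :=
  (eps^-1)%:C *: Bhathat (B (eps *: x)) + Ehat (E x).

Section Step.
Variables (eps h : R) (E B : 'cV[R]_3 -> 'cV[R]_3).
Variables (y u : 'cV[R[i]]_4).

Let F := Fmx eps E B (position y).
Let h2 := (h / 2)%:C.

Definition ybar : 'cV[R[i]]_4 := y + h2 *: (mx_phi1 (h2 *: F) *m u).

Let Fbar := Fmx eps E B (position ybar).

Definition SS2xn_y : 'cV[R[i]]_4 :=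
  y + h2 *: (mx_phi1 (h2 *: F)
             *m (1%:M + mx_exp (h%:C *: (Fbar - F)) *m mx_exp (h2 *: F)) *m u).

Definition SS2xn_u : 'cV[R[i]]_4 :=
  mx_exp (h2 *: F) *m mx_exp (h%:C *: (Fbar - F)) *m mx_exp (h2 *: F) *m u.

End Step.

(* (y, u) is the numerical solution with real initial data x0, v0 and
   imaginary initial components i t0, i gamma0. *)
Definition SS2xn_solution eps h E B
    (x0 : 'cV[R]_3) (t0 : R) (v0 : 'cV[R]_3) (gamma0 : R)
    (y u : nat -> 'cV[R[i]]_4) : Prop :=
  [/\ y 0%N = vec4 x0 t0, u 0%N = vec4 v0 gamma0 &
      forall n, y n.+1 = SS2xn_y eps h E B (y n) (u n) /\
                u n.+1 = SS2xn_u eps h E B (y n) (u n)].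

Definition enorm (m : nat) (v : 'cV[R[i]]_m) : R[i] :=
  sqrtC (\sum_j `|v j 0| ^+ 2).

(* The norm of v is Hermitian, but the square of w is not conjugated. *)
Definition energy (x : 'cV[R[i]]_3) (t : R[i]) (v : 'cV[R[i]]_3) (w : R[i])
    : R[i] :=
  2^-1 * enorm v ^+ 2 + 2^-1 * w ^+ 2.

End ChargedParticle.

(* Main.v *)
Require Import Defs.
From HB Require Import structures.
From mathcomp Require Import all_boot all_order all_algebra.
From mathcomp Require Import complex ring.
From mathcomp Require Import all_classical all_reals all_analysis.
Import Order.TTheory GRing.Theory Num.Theory numFieldNormedType.Exports.

Set Implicit Arguments.
Unset Strict Implicit.
Unset Printing Implicit Defensive.

Local Open Scope ring_scope.
Local Open Scope complex_scope.

(** The energy is half the non-conjugated square u^T u of the 4-velocity u,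
    provided that u has three real entries and an imaginary last one; for other
    u the Hermitian norm of the spatial part would spoil this.  Every field
    matrix F is skew-symmetric, hence so are F_xbar - F and all their real
    multiples, and the exponential of a skew-symmetric matrix is orthogonal; the
    step sends u to a product of three such exponentials applied to u, so u^T u
    is unchanged.

    Both facts needed, orthogonality and the reality pattern of u, are obtained
    at once by undoing the substitution w = i gamma.  Conjugation by the diagonal
    matrix wick = diag(1, 1, 1, i) turns F into a real matrix G
    ([Fmx_complexify]), vectors with the reality pattern into real vectors r, and
    the non-conjugated square into the Minkowski form r^T J r with
    J = diag(1, 1, 1, -1) ([energy_wick]).  Skew-symmetry of F becomes
    G^T J = - J G, that is, G lies in the Lorentz Lie algebra
    ([field_mx_skew]), and exp G then preserves J ([mx_exp_isometry]):
    (exp G)^T J = exp (G^T) J = J exp (- G).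

    The analytic input is that the real exponential series converges, and that
    exp (X + Y) = exp X exp Y for commuting X and Y ([mx_expD]).  The latter
    compares partial sums: the product of those of X and Y differs from that of
    X + Y by monomials X^i Y^j with i + j large, and these are dominated entrywise
    by the same remainder for real numbers c, d bounding X and Y, which tends to
    e^c e^d - e^(c + d) = 0. *)

(** * Products of partial sums of the exponential series *)

(** Splits the square i, j < N along its antidiagonals: the first sum collects
    the complete ones, i + j = k < N, the second the incomplete ones. *)
Lemma sum_square_split (V : nmodType) (f : nat -> nat -> V) (N : nat) :
  \sum_(0 <= i < N) \sum_(0 <= j < N) f i j =
  \sum_(0 <= k < N) \sum_(j < k.+1) f (k - j)%N j +
  \sum_(0 <= i < N) \sum_(0 <= j < N | (N <= i + j)%N) f i j.
Proof.
under [LHS]eq_bigr => i _.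
  rewrite (bigID (fun j => (N <= i + j)%N)) /= addrC; over.
rewrite big_split /=; congr (_ + _).
rewrite (exchange_big_dep_nat xpredT) //=.
under [RHS]eq_big_nat => k /andP[_ kN].
  rewrite -(big_mkord xpredT (fun j => f (k - j)%N j)) (big_nat_widen _ _ N) //.
  over.
rewrite [RHS](exchange_big_dep_nat xpredT) //=.
apply: eq_bigr => j _.
transitivity (\sum_(j <= k < N) f (k - j)%N j); last first.
  by rewrite (big_nat_widenl _ 0) //; apply: eq_bigl => k; rewrite ltnS.
rewrite -{3}[j]add0n big_addn [RHS](big_nat_widen _ _ N) ?leq_subr//.
apply: eq_big => [i|i _]; last by rewrite addnK.
by rewrite -ltnNge /= ltn_subRL addnC.
Qed.

(** The complete antidiagonals are the binomial expansions of (x + y)^k / k!.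
    The remainder is kept explicit, with positive coefficients, so that instances
    in different algebras can be compared term by term. *)
Lemma exp_partial_sumsM (K : numFieldType) (A : algType K) (x y : A) (N : nat) :
  GRing.comm x y ->
  series (fun k => k`!%:R^-1 *: x ^+ k) N * series (fun k => k`!%:R^-1 *: y ^+ k) N =
  series (fun k => k`!%:R^-1 *: (x + y) ^+ k) N +
  \sum_(0 <= i < N) \sum_(0 <= j < N | (N <= i + j)%N)
     (i`!%:R * j`!%:R)^-1 *: (x ^+ i * y ^+ j).
Proof.
move=> cxy; rewrite /series /= mulr_suml.
under [LHS]eq_bigr => i _ do rewrite mulr_sumr.
rewrite sum_square_split; congr (_ + _).
  apply: eq_bigr => k _; rewrite exprDn_comm // scaler_sumr.
  apply: eq_bigr => j _.
  rewrite -scalerAl -scalerAr scalerA -[X in _ = _ *: X]scaler_nat !scalerA; congr (_ *: _).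
  have jk : (j <= k)%N by rewrite -ltnS.
  rewrite -(bin_fact jk) !natrM.
  by field; rewrite !pnatr_eq0 -!lt0n !fact_gt0 bin_gt0.
by do 2![apply: eq_bigr => ? _]; rewrite -scalerAl -scalerAr scalerA invfM.
Qed.

(** * Limits of matrices *)

Section MatrixLimits.
Variable K : numFieldType.
Local Open Scope classical_set_scope.

Lemma mx_cvgP m n (A : nat -> 'M[K]_(m, n)) (L : 'M[K]_(m, n)) :
  A @ \oo --> L <-> forall i j, (fun k => A k i j) @ \oo --> L i j.
Proof.
split=> [AL i j|AL].
  exact: cvg_comp _ _ AL (@coord_continuous K m n i j L).
apply/cvg_mx_entourageP => e ent_e.
have H i j : \forall k \near \oo, (L i j, A k i j) \in e.
  have := (cvg_entourageP _ _).1 (AL i j) e ent_e.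
  by move=> Ae; near=> k; rewrite inE; near: k; exact: Ae.
near=> k => i j; move: i j; near: k.
exact: (@filter_forall _ _ _ _ _ (fun i => @filter_forall _ _ _ _ _ (H i))).
Unshelve. all: by end_near. Qed.

Lemma cvg_mulmx m n p (A : nat -> 'M[K]_(m, n)) (B : nat -> 'M[K]_(n, p))
    (L : 'M[K]_(m, n)) (M : 'M[K]_(n, p)) :
  A @ \oo --> L -> B @ \oo --> M -> (fun k => A k *m B k) @ \oo --> L *m M.
Proof.
move=> /mx_cvgP AL /mx_cvgP BM; apply/mx_cvgP => i j.
rewrite mxE; under eq_fun => k do rewrite mxE.
by apply: (cvg_big add_continuous) => l _; apply: cvgM.
Qed.

Lemma cvg_trmx m n (A : nat -> 'M[K]_(m, n)) (L : 'M[K]_(m, n)) :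
  A @ \oo --> L -> (fun k => (A k)^T) @ \oo --> L^T.
Proof.
move=> /mx_cvgP AL; apply/mx_cvgP => i j.
by rewrite mxE; under eq_fun => k do rewrite mxE; exact: AL.
Qed.

Lemma mx_exp_unique m (A L : 'M[K]_m.+1) :
  series (fun k => k`!%:R^-1 *: A ^+ k) @ \oo --> L -> mx_exp A = L.
Proof. by move=> AL; apply/cvg_lim. Qed.

End MatrixLimits.

(** * The exponential of a real matrix *)

Section RealMatrixExponential.
Variable R : realType.
Local Open Scope classical_set_scope.

(** Chosen to dominate every row sum, which is what the induction on powers
    uses. *)
Definition abs_sum m n (A : 'M[R]_(m, n)) : R := \sum_i \sum_j `|A i j|.

Lemma abs_sum_ge0 m n (A : 'M[R]_(m, n)) : 0 <= abs_sum A.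
Proof. by apply: sumr_ge0 => i _; apply: sumr_ge0. Qed.

Lemma row_abs_sum m n (A : 'M[R]_(m, n)) i : \sum_j `|A i j| <= abs_sum A.
Proof.
rewrite /abs_sum (bigD1 i) //= lerDl.
by apply: sumr_ge0 => k _; apply: sumr_ge0.
Qed.

(** Multiplying on the left by A enlarges the entries by at most the largest
    row sum of A.  The factor M makes the bound apply to mixed products
    X^i Y^j without the loss of a dimension factor. *)
Lemma entry_mul_exprn_le m n (A : 'M[R]_m.+1) (M : 'M[R]_(m.+1, n)) (d : R) :
  (forall i j, `|M i j| <= d) ->
  forall k i j, `|(A ^+ k *m M) i j| <= abs_sum A ^+ k * d.
Proof.
move=> Md; elim=> [|k IHk] i j; first by rewrite mul1mx mul1r.
rewrite exprS -mulmxA mxE (le_trans (ler_norm_sum _ _ _)) // exprS -mulrA.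
apply: (@le_trans _ _ (\sum_l `|A i l| * (abs_sum A ^+ k * d))).
  by apply: ler_sum => l _; rewrite normrM ler_wpM2l.
rewrite -mulr_suml ler_wpM2r ?row_abs_sum //.
by rewrite (le_trans _ (IHk i j)).
Qed.

Lemma entry_exprn_le m (A : 'M[R]_m.+1) k i j : `|(A ^+ k) i j| <= abs_sum A ^+ k.
Proof.
rewrite -[A ^+ k]mulmx1 -[abs_sum A ^+ k]mulr1; apply: entry_mul_exprn_le => a b.
by rewrite mxE normr_nat; case: (a == b).
Qed.

(** Entrywise absolute convergence, by comparison with the real exponential
    series at [abs_sum A]. *)
Lemma cvg_mx_exp m (A : 'M[R]_m.+1) :
  series (fun k => k`!%:R^-1 *: A ^+ k) @ \oo --> mx_exp A.
Proof.
pose u i j := series (fun k => k`!%:R^-1 * (A ^+ k) i j).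
have cvg_u i j : cvgn (u i j).
  apply: normed_cvg; apply: series_le_cvg (is_cvg_series_exp_coeff (abs_sum A)) => k //=.
    by rewrite exp_coeff_ge0 ?abs_sum_ge0.
  rewrite /exp_coeff /= normrM mulrC [`|_^-1|]ger0_norm ?invr_ge0 ?ler0n //.
  by rewrite ler_wpM2r ?invr_ge0 ?ler0n ?entry_exprn_le.
apply/cvg_ex; exists (\matrix_(i, j) limn (u i j)).
apply/mx_cvgP => i j; rewrite mxE.
rewrite (_ : (fun k => _) = u i j); first exact: cvg_u.
by apply/funext => n; rewrite summxE; apply: eq_bigr => k _; rewrite mxE.
Qed.

(** The real exponential, with the reals seen as an algebra over themselves
    so that [exp_partial_sumsM] applies to it. *)
Lemma cvg_expR (x : R) :
  series (fun k => k`!%:R^-1 *: (x : R^o) ^+ k) @ \oo --> expR x.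
Proof.
rewrite (_ : series _ = series (exp_coeff x)); first exact: is_cvg_series_exp_coeff.
by apply/funext => n; apply: eq_bigr => k _; rewrite /exp_coeff /= mulrC.
Qed.

(** The difference between the product of the partial sums and the partial sum
    of X + Y has entries bounded by the analogous difference for the numbers
    c = [abs_sum X] and d = [abs_sum Y], which tends to 0 by [expRD]. *)
Lemma mx_expD m (X Y : 'M[R]_m.+1) :
  GRing.comm X Y -> mx_exp (X + Y) = mx_exp X *m mx_exp Y.
Proof.
move=> cXY; apply: mx_exp_unique.
pose S (A : algType R) (x : A) := series (fun k => k`!%:R^-1 *: x ^+ k).
have SM (A : algType R) (x y : A) N : GRing.comm x y ->
    S A x N * S A y N - S A (x + y) N =
    \sum_(0 <= i < N) \sum_(0 <= j < N | (N <= i + j)%N)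
       (i`!%:R * j`!%:R)^-1 *: (x ^+ i * y ^+ j).
  by move=> cxy; rewrite /S exp_partial_sumsM // addrAC subrr add0r.
pose c : R^o := abs_sum X; pose d : R^o := abs_sum Y.
rewrite -/(S _ _).
pose Rem N := S _ X N *m S _ Y N - S _ (X + Y) N.
have Rem0 : Rem @ \oo --> (0 : 'M[R]_m.+1).
  apply/mx_cvgP => i j; rewrite mxE.
  pose b N := S _ c N * S _ d N - S _ (c + d) N.
  have b0 : b @ \oo --> (0 : R).
    rewrite (_ : 0 = expR c * expR d - expR (c + d)); last by rewrite expRD subrr.
    by apply: cvgB; [apply: cvgM|]; exact: cvg_expR.
  apply/norm_cvg0P.
  apply: (squeeze_cvgr _ (cvg_cst 0) b0); near=> N; rewrite normr_ge0 /=.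
  rewrite [b N](SM _ c d N (mulrC c d)) [Rem N](SM _ X Y N cXY).
  rewrite summxE (le_trans (ler_norm_sum _ _ _)) //.
  apply: ler_sum => k _; rewrite summxE (le_trans (ler_norm_sum _ _ _)) //.
  apply: ler_sum => l _; rewrite mxE normrM ger0_norm ?invr_ge0 ?mulr_ge0 //.
  apply: ler_wpM2l; first by rewrite ?invr_ge0 ?mulr_ge0.
  by apply: entry_mul_exprn_le => i2 j2; apply: entry_exprn_le.
rewrite (_ : S _ (X + Y) = (fun N => S _ X N *m S _ Y N - Rem N)); last first.
  by apply/funext => N; rewrite /Rem subKr.
rewrite -[X in _ --> X]subr0; apply: cvgB => //.
by apply: cvg_mulmx; exact: cvg_mx_exp.
Unshelve. all: by end_near. Qed.

Lemma mx_exp0 m : mx_exp (0 : 'M[R]_m.+1) = 1.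
Proof.
apply: mx_exp_unique; rewrite -cvg_shiftS /=.
rewrite (_ : (fun _ => _) = cst 1); first exact: cvg_cst.
apply/funext => n; rewrite /series /= big_nat_recl //= big1 ?addr0 ?expr0 ?invr1 ?scale1r //.
by move=> i _; rewrite exprS mul0r scaler0.
Qed.

Lemma mx_expN m (A : 'M[R]_m.+1) : mx_exp (- A) *m mx_exp A = 1%:M.
Proof. by rewrite -mx_expD ?addNr ?mx_exp0 //; apply/commr_sym/commrN. Qed.

Lemma mx_exp_tr m (A : 'M[R]_m.+1) : mx_exp A^T = (mx_exp A)^T.
Proof.
apply: mx_exp_unique.
rewrite (_ : series _ = (fun n => (series (fun k => k`!%:R^-1 *: A ^+ k) n)^T)).
  by apply: cvg_trmx; exact: cvg_mx_exp.
apply/funext => n; rewrite /series /= linear_sum; apply: eq_bigr => k _.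
rewrite linearZ; congr (_ *: _).
elim: k => [|k IHk]; first exact/esym/trmx1.
by rewrite exprS IHk exprSr; exact/esym/trmx_mul.
Qed.

(** An intertwiner of A and B intertwines all their powers, hence all partial
    sums of the series. *)
Lemma mx_exp_intertwine m n (A : 'M[R]_m.+1) (B : 'M[R]_n.+1) (J : 'M[R]_(m.+1, n.+1)) :
  A *m J = J *m B -> mx_exp A *m J = J *m mx_exp B.
Proof.
move=> AJ.
have AJk k : A ^+ k *m J = J *m B ^+ k.
  elim: k => [|k IHk]; first by rewrite mul1mx mulmx1.
  by rewrite exprSr -mulmxA AJ mulmxA IHk -mulmxA exprSr.
have JB : (fun N => J *m series (fun k => k`!%:R^-1 *: B ^+ k) N) @ \oo
    --> J *m mx_exp B by apply: cvg_mulmx; [exact: cvg_cst|exact: cvg_mx_exp].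
apply: cvg_unique JB => //.
rewrite (_ : (fun N => _) = (fun N => series (fun k => k`!%:R^-1 *: A ^+ k) N *m J)).
  by apply: cvg_mulmx; [exact: cvg_mx_exp|exact: cvg_cst].
apply/funext => N; rewrite /series /= mulmx_sumr mulmx_suml; apply: eq_bigr => k _.
by rewrite -scalemxAl -scalemxAr AJk.
Qed.

(** The Lie algebra of the group of isometries of a bilinear form J consists of
    the matrices skew for J; its exponentials are isometries because J
    intertwines - A and A^T. *)
Lemma mx_exp_isometry m (A J : 'M[R]_m.+1) :
  A^T *m J = - (J *m A) -> (mx_exp A)^T *m J *m mx_exp A = J.
Proof.
move=> AJ; rewrite -mx_exp_tr (@mx_exp_intertwine _ _ _ (- A)) ?mulmxN //.
by rewrite -mulmxA mx_expN mulmx1.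
Qed.

End RealMatrixExponential.

(** * Imaginary time: passing between real and complex matrices *)

Section Complexification.
Variable R : realType.
Local Open Scope classical_set_scope.

Lemma toC0 m n : toC (0 : 'M[R]_(m, n)) = 0.
Proof. exact: map_mx0. Qed.

Lemma toC_block_mx m1 m2 n1 n2 (P : 'M[R]_(m1, n1)) (Q : 'M[R]_(m1, n2))
    (S : 'M[R]_(m2, n1)) (T : 'M[R]_(m2, n2)) :
  toC (block_mx P Q S T) = block_mx (toC P) (toC Q) (toC S) (toC T).
Proof. exact: map_block_mx. Qed.

Lemma toC_col_mx m1 m2 n (P : 'M[R]_(m1, n)) (Q : 'M[R]_(m2, n)) :
  toC (col_mx P Q) = col_mx (toC P) (toC Q).
Proof. exact: map_col_mx. Qed.

Lemma cvg_real_complex (f : nat -> R) (l : R) :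
  f @ \oo --> l ->
  (fun n => (f n)%:C : (R[i] : numFieldType)) @ \oo --> (l%:C : (R[i] : numFieldType)).
Proof.
move=> fl; apply/cvgrPdist_lt => e e0.
(* A positive complex radius is a positive real one. *)
have [/eqP Ie Re0] : complex.Im e == 0 /\ 0 < complex.Re e.
  by move: e0; rewrite ltcE => /andP[].
move/cvgrPdist_lt : fl => /(_ _ Re0) fl; near=> n.
rewrite -rmorphB /= normc_def /= expr0n addr0 sqrtr_sqr ltcE /= Ie eqxx /=.
by near: n.
Unshelve. all: by end_near. Qed.

(** Wick rotation: it sends (a, s) to (a, i s), so the image of the real vectors
    is the set of vectors with the reality pattern of positions and
    velocities. *)
Definition wick : 'M[R[i]]_4 :=
  block_mx (1%:M : 'M[R[i]]_3) 0 0 ('i%:M : 'M[R[i]]_1).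

Definition wick_inv : 'M[R[i]]_4 :=
  block_mx (1%:M : 'M[R[i]]_3) 0 0 ((- 'i)%:M : 'M[R[i]]_1).

Lemma mulVwick : wick_inv *m wick = 1%:M.
Proof.
rewrite /wick /wick_inv (mulmx_block (m1 := 3) (n1 := 3) (p1 := 3)).
rewrite !mulmx0 !mul0mx !addr0 add0r mul1mx -scalar_mxM mulNr -expr2 sqr_i opprK.
by rewrite -scalar_mx_block.
Qed.

Definition complexify (G : 'M[R]_4) : 'M[R[i]]_4 := wick *m toC G *m wick_inv.

Lemma complexifyM (G H : 'M[R]_4) :
  complexify (G *m H) = complexify G *m complexify H.
Proof.
by rewrite /complexify /toC map_mxM !mulmxA -(mulmxA _ wick_inv wick) mulVwick mulmx1.
Qed.

Lemma complexifyZ (a : R) (G : 'M[R]_4) : complexify (a *: G) = a%:C *: complexify G.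
Proof. by rewrite /complexify /toC map_mxZ -scalemxAr -scalemxAl. Qed.

Lemma complexifyB (G H : 'M[R]_4) : complexify (G - H) = complexify G - complexify H.
Proof. by rewrite /complexify /toC map_mxB mulmxBr mulmxBl. Qed.

Lemma complexify_mul_wick (G : 'M[R]_4) (r : 'cV[R]_4) :
  complexify G *m (wick *m toC r) = wick *m toC (G *m r).
Proof.
by rewrite /complexify /toC map_mxM !mulmxA -(mulmxA _ wick_inv wick) mulVwick mulmx1.
Qed.

(** [complexify] is multiplicative, real-linear and continuous, so it commutes
    with power series; in particular the complex series converges. *)
Lemma mx_exp_complexify (G : 'M[R]_4) : mx_exp (complexify G) = complexify (mx_exp G).
Proof.
apply: mx_exp_unique.
have powE k : complexify G ^+ k = complexify (G ^+ k).
  elim: k => [|k IHk]; last by rewrite !exprS complexifyM IHk.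
  rewrite !expr0 /complexify /toC map_mx1 mulmx1; symmetry.
  exact: (mulmx1C mulVwick).
rewrite (_ : series _ = (fun N =>
    complexify (series (fun k => k`!%:R^-1 *: G ^+ k) N))); last first.
  apply/funext => N; rewrite /series /= /complexify /toC map_mx_sum mulmx_sumr mulmx_suml.
  apply: eq_bigr => k _; rewrite powE.
  by rewrite -[RHS]/(complexify _) complexifyZ fmorphV rmorph_nat.
apply: cvg_mulmx; last exact: cvg_cst.
apply: cvg_mulmx; first exact: cvg_cst.
have /mx_cvgP expG := @cvg_mx_exp _ _ G.
apply/mx_cvgP => i j; rewrite mxE; under eq_fun => k do rewrite mxE.
exact: cvg_real_complex.
Qed.

End Complexification.

(** * Lorentz geometry of the scheme *)

Section Lorentz.
Variable R : realType.

Definition minkowski : 'M[R]_4 :=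
  block_mx (1%:M : 'M[R]_3) 0 0 ((-1)%:M : 'M[R]_1).

(** The electromagnetic field tensor with real time, before Wick rotation. *)
Definition field_mx (a : R) (b e : 'cV[R]_3) : 'M[R]_4 :=
  a *: block_mx (Bhat b) 0 0 (0 : 'M[R]_1) + block_mx (0 : 'M[R]_3) e e^T 0.

Lemma Bhat_tr (b : 'cV[R]_3) : (Bhat b)^T = - Bhat b.
Proof.
apply/matrixP => j k; rewrite !mxE.
by case: j => [[|[|[|]]]] //= _; case: k => [[|[|[|]]]] //= _; rewrite ?oppr0 ?opprK.
Qed.

Definition minkowski_skew (G : 'M[R]_4) := G^T *m minkowski = - (minkowski *m G).

Definition minkowski_isometry (M : 'M[R]_4) := M^T *m minkowski *m M = minkowski.

(** The magnetic block is skew and the electric blocks e and e^T are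
    symmetric: infinitesimal rotations and boosts. *)
Lemma field_mx_skew a b e : minkowski_skew (field_mx a b e).
Proof.
rewrite /minkowski_skew /field_mx /minkowski scale_block_mx add_block_mx.
rewrite (tr_block_mx (m1 := 3) (n1 := 3)).
rewrite !(mulmx_block (m1 := 3) (n1 := 3) (p1 := 3)) (opp_block_mx (m1 := 3) (n1 := 3)).
rewrite !scaler0 !add0r !addr0 !mulmx0 !mul0mx !addr0 !add0r trmxK !trmx0.
rewrite !mul0mx ?mulmx0 ?oppr0 !mulmx1 !mul1mx linearZ /= Bhat_tr scalerN.
rewrite mul_scalar_mx scaleN1r opprK.
by rewrite mul_mx_scalar scaleN1r.
Qed.

Lemma minkowski_skewZ (a : R) (G : 'M[R]_4) :
  minkowski_skew G -> minkowski_skew (a *: G).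
Proof.
by rewrite /minkowski_skew => HG; rewrite linearZ /= -scalemxAl HG -scalemxAr scalerN.
Qed.

Lemma minkowski_skewB (G H : 'M[R]_4) :
  minkowski_skew G -> minkowski_skew H -> minkowski_skew (G - H).
Proof.
rewrite /minkowski_skew => HG HH.
by rewrite linearB /= mulmxBl HG HH mulmxBr opprB opprK addrC.
Qed.

(** The electric blocks e, e^T pick up the factors - i and i, the inverse of
    the last entry of [wick] on the right and that entry on the left. *)
Lemma Fmx_complexify eps (E B : 'cV[R]_3 -> 'cV[R]_3) x :
  Fmx eps E B x = complexify (field_mx eps^-1 (B (eps *: x)) (E x)).
Proof.
have -> : complexify (field_mx eps^-1 (B (eps *: x)) (E x)) =
    (eps^-1)%:C *: complexify (block_mx (Bhat (B (eps *: x))) 0 0 (0 : 'M[R]_1)) +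
    complexify (block_mx (0 : 'M[R]_3) (E x) (E x)^T 0).
  by rewrite -complexifyZ /complexify -mulmxDl -mulmxDr /toC -map_mxD.
rewrite /complexify !(toC_block_mx (m1 := 3) (n1 := 3)) /wick /wick_inv.
rewrite !(mulmx_block (m1 := 3) (n1 := 3) (p1 := 3)).
rewrite !toC0 !(mul0mx, mulmx0, addr0, add0r, mul1mx, mulmx1).
rewrite mul_mx_scalar mul_scalar_mx.
by rewrite /Fmx /Bhathat /Ehat /toC map_trmx.
Qed.

Lemma wick_col_mx (a : 'cV[R]_3) (b : 'cV[R]_1) :
  wick R *m toC (col_mx a b) = col_mx (toC a) ('i *: toC b).
Proof.
rewrite (toC_col_mx (m1 := 3)) /wick (mul_block_col (m1 := 3) (n1 := 3)).
by rewrite !mul0mx addr0 add0r mul1mx mul_scalar_mx.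
Qed.

Lemma vec4_wick (a : 'cV[R]_3) s : vec4 a s = wick R *m toC (col_mx a s%:M).
Proof. by rewrite wick_col_mx /vec4 scalar_mxM mul_scalar_mx /toC map_scalar_mx. Qed.

(** On vectors with real spatial part the Hermitian norm is the plain sum of
    squares, and the square of i b contributes - b^2. *)
Lemma energy_wick x t (r : 'cV[R]_4) :
  energy x t (spatial (wick R *m toC r)) (last_entry (wick R *m toC r)) =
  (2^-1 * (r^T *m minkowski *m r) 0 0)%:C.
Proof.
have [a [b ->]] : exists a b, r = col_mx a b :> 'cV[R]_(3 + 1).
  by exists (usubmx (r : 'cV[R]_(3 + 1))), (dsubmx (r : 'cV[R]_(3 + 1))); rewrite vsubmxK.
(* The Minkowski form in coordinates. *)
have -> : ((col_mx a b)^T *m minkowski *m col_mx a b) 0 0 =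
    \sum_j a j 0 ^+ 2 - b 0 0 ^+ 2.
  rewrite /minkowski (tr_col_mx (m1 := 3)) (mul_row_block (n1 := 3) (p1 := 3)).
  rewrite !mulmx0 addr0 add0r mulmx1 (mul_row_col (n1 := 3)) mul_mx_scalar scaleN1r.
  rewrite mulNmx !mxE big_ord1 !mxE -expr2; congr (_ - _).
  by apply: eq_bigr => j _; rewrite mxE expr2.
rewrite wick_col_mx /energy /spatial (col_mxKu (m1 := 3)) /enorm sqrtCK /last_entry.
have -> : (ord_max : 'I_4) = rshift 3 (ord0 : 'I_1) by apply/val_inj.
rewrite (col_mxEd (m1 := 3)) !mxE exprMn sqr_i mulN1r -mulrDr rmorphM fmorphV rmorph_nat.
rewrite rmorphB rmorphXn rmorph_sum /=; congr (_ * (_ - _)).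
apply: eq_bigr => j _; rewrite mxE rmorphXn /=.
by rewrite -add_Re2_Im2 /= expr0n addr0 rmorphXn.
Qed.

Lemma minkowski_isometryM (M N : 'M[R]_4) :
  minkowski_isometry M -> minkowski_isometry N -> minkowski_isometry (M *m N).
Proof.
rewrite /minkowski_isometry => HM HN.
by rewrite -[RHS]HN -[X in _ = _ *m X *m _]HM trmx_mul !mulmxA.
Qed.

Lemma minkowski_isometry_form (M : 'M[R]_4) (r : 'cV[R]_4) :
  minkowski_isometry M ->
  (M *m r)^T *m minkowski *m (M *m r) = r^T *m minkowski *m r.
Proof.
rewrite /minkowski_isometry => HM.
by rewrite -[in RHS]HM trmx_mul !mulmxA.
Qed.

(** M depends on r, because the intermediate point at which the second field matrix is
    taken does. *)
Lemma SS2xn_u_wick eps h (E B : 'cV[R]_3 -> 'cV[R]_3) y (r : 'cV[R]_4) :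
  exists2 M, minkowski_isometry M &
    SS2xn_u eps h E B y (wick R *m toC r) = wick R *m toC (M *m r).
Proof.
pose G x := field_mx eps^-1 (B (eps *: x)) (E x).
pose z := ybar eps h E B y (wick R *m toC r).
pose P := mx_exp ((h / 2) *: G (position y)).
pose Q := mx_exp (h *: (G (position z) - G (position y))).
have isoP : minkowski_isometry P.
  by apply/mx_exp_isometry/minkowski_skewZ; exact: field_mx_skew.
have isoQ : minkowski_isometry Q.
  by apply/mx_exp_isometry/minkowski_skewZ/minkowski_skewB; exact: field_mx_skew.
exists (P *m Q *m P); first by do 2?apply: minkowski_isometryM.
rewrite /SS2xn_u -/z !Fmx_complexify -complexifyB -!complexifyZ !mx_exp_complexify.
by rewrite -!complexifyM complexify_mul_wick.
Qed.

End Lorentz.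

Theorem proposition2p2 (R : realType) (eps h : R)
    (U : 'cV[R]_3 -> R) (E B : 'cV[R]_3 -> 'cV[R]_3)
    (x0 : 'cV[R]_3) (t0 : R) (v0 : 'cV[R]_3) (gamma0 : R)
    (y u : nat -> 'cV[R[i]]_4) :
  0 < eps < 1 -> 0 < h ->
  (forall x, differentiable U x) -> (forall x, E x = - gradient U x) ->
  SS2xn_solution eps h E B x0 t0 v0 gamma0 y u ->
  forall n : nat,
    energy (spatial (y n.+1)) (last_entry (y n.+1))
           (spatial (u n.+1)) (last_entry (u n.+1))
    = energy (spatial (y n)) (last_entry (y n))
             (spatial (u n)) (last_entry (u n)).
Proof.
move=> _ _ _ _ [_ u0 step] n.
(* The reality pattern of the velocity propagates along the solution. *)
have [r ur] : exists r, u n = wick R *m toC r.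
  elim: n => [|n [r ur]]; first by exists (col_mx v0 gamma0%:M); rewrite u0 vec4_wick.
  have [M _ uM] := SS2xn_u_wick eps h E B (y n) r.
  by exists (M *m r); rewrite (step n).2 ur.
have [M isoM uM] := SS2xn_u_wick eps h E B (y n) r.
by rewrite (step n).2 ur uM !energy_wick minkowski_isometry_form.
Qed.
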